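(* Under Assumptions (A1)--(A8) below, let $\mathcal{P}_n^*=\{P_{j,n}^*\}_{j=1}^{k_n}$ be an optimal SMML partition of the countable data space $\mathcal{X}_n$ with codepoints $\bm\theta_{j,n}^*=\arg\max_{\bm\theta\in\Theta}\sum_{\mathbf{x}\in P_{j,n}^*}r_n(\mathbf{x})\ell_n(\mathbf{x}\mid\bm\theta)$ (assumed to lie in the interior of $\Theta$), $q_{j,n}^*=\sum_{\mathbf{x}\in P_{j,n}^*}r_n(\mathbf{x})>0$ and weights $w_{j,n}(\mathbf{x})=r_n(\mathbf{x})/q_{j,n}^*$ for $\mathbf{x}\in P_{j,n}^*$. Fix a compact $K\subset\Theta$ on which (A5) holds and consider any sequence of cells with $\bm\theta_{j,n}^*\in K$. Then $$\bm\theta_{j,n}^*=\sum_{\mathbf{x}\in P_{j,n}^*}w_{j,n}(\mathbf{x})\hat{\bm\theta}(\mathbf{x})+\bm\varepsilon_{j,n},\qquad\|\bm\varepsilon_{j,n}\|=o(n^{-1/2})\ \ (n\to\infty),$$ equivalently $\bm\theta_{j,n}^*=\mathbb{E}_{r_n}[\hat{\bm\theta}(\mathbf{X})\mid\mathbf{X}\in P_{j,n}^*]+o(n^{-1/2})$.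
   Context: Setting: $X_1,\dots,X_n$ i.i.d. from a parametric family with per-observation density/mass $f(\cdot\mid\bm\theta)$, $\bm\theta\in\Theta\subseteq\mathbb{R}^p$; a data set $\mathbf{x}=(x_1,\dots,x_n)$ lies in a countable sample space $\mathcal{X}_n$; $p_n(\mathbf{x}\mid\bm\theta)$ is the joint likelihood, $\ell_n(\mathbf{x}\mid\bm\theta)=\log p_n(\mathbf{x}\mid\bm\theta)$; $\pi$ is a prior density; $r_n(\mathbf{x})=\int_\Theta p_n(\mathbf{x}\mid\bm\theta)\pi(\bm\theta)d\bm\theta$. For a finite partition $\mathcal{P}=\{P_1,\dots,P_k\}$ of $\mathcal{X}_n$ with $q_j=\sum_{\mathbf{x}\in P_j}r_n(\mathbf{x})>0$, the SMML codepoint of $P_j$ is $\bm\theta_j^*=\arg\max_{\bm\theta}\sum_{\mathbf{x}\in P_j}r_n(\mathbf{x})\log p_n(\mathbf{x}\mid\bm\theta)$ and the expected codelength is $\mathcal{I}(\mathcal{P})=-\sum_j q_j\log q_j-\sum_j\sum_{\mathbf{x}\in P_j}r_n(\mathbf{x})\log p_n(\mathbf{x}\mid\bm\theta_j^* )$; an optimal SMML partition minimises $\mathcal{I}$ over the admissible partitions. $\hat{\bm\theta}(\mathbf{x})$ is the MLE. ${\bf J}_1(\bm\theta)=\mathbb{E}_{\bm\theta}[\nabla\log f(X_1\mid\bm\theta)\nabla\log f(X_1\mid\bm\theta)']$ is the per-observation Fisher information; $d_F$ is the per-observation Fisher--Rao distance, the Riemannian distance of the metric ${\bf J}_1$. Assumptions: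 (A1) $\Theta$ is open in $\mathbb{R}^p$. (A2) The true parameter $\bm\theta_0\in\operatorname{int}(\Theta)$. (A3) The support of $f(\cdot\mid\bm\theta)$ does not depend on $\bm\theta$; $\pi$ is a proper density, continuous and strictly positive near $\bm\theta_0$; $r_n(\mathbf{x})<\infty$ for all $n,\mathbf{x}$. (A4) $\bm\theta\mapsto\log p_n(\mathbf{x}\mid\bm\theta)$ is $C^3$ on $\Theta$ for each $\mathbf{x}$, and the MLE $\hat{\bm\theta}(\mathbf{x})$ exists in $\Theta$ for all data sets in the SMML cells considered. (A5) ${\bf J}_1$ exists and for every compact $K\subset\Theta$ there are $0<c_1(K)\le c_2(K)<\infty$ with $c_1(K){\bf I}_p\preceq{\bf J}_1(\bm\theta)\preceq c_2(K){\bf I}_p$ for $\bm\theta\in K$. (A6) Differentiation under the integral sign is valid where used. (A7) For every compact $K\subset\Theta$ on which (A5) holds, the local mesh size of the SMML quantisation measured in $d_F$ is $O(n^{-1/2})$ uniformly on $K$; in particular, for cells with $\bm\theta_{j,n}^*\in K$, $\sup_{\mathbf{x}\in P_{j,n}^*}d_F(\hat{\bm\theta}(\mathbf{x}),\bm\theta_{j,n}^* )=O(n^{-1/2})$. (A8) For a compact $K$ on which (A5) holds and any sequence of SMML cells $P_{j,n}^*$ with $\bm\theta_{j,n}^*\in K$: for all large $n$ and every $\mathbf{x}\in P_{j,n}^*$ there is $\tilde{\bm\theta}_{j,n}(\mathbf{x})$ on the segment between $\hat{\bm\theta}(\mathbf{x})$ and $\bm\theta_{j,n}^*$ (the one arising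 in the mean-value expansion of the score) with $-\frac1n\nabla^2_{\bm\theta}\ell_n(\mathbf{x}\mid\tilde{\bm\theta}_{j,n}(\mathbf{x}))={\bf J}_1(\bm\theta_{j,n}^* )+{\bf R}_{j,n}(\mathbf{x})$, where $\sup_{\mathbf{x}\in P_{j,n}^*}\|{\bf R}_{j,n}(\mathbf{x})\|=o(1)$. *)

(* Defs.v *)
From HB Require Import structures.
From mathcomp Require Import all_boot all_order all_algebra.
From mathcomp Require Import all_classical all_reals all_analysis.

Set Implicit Arguments.
Unset Strict Implicit.
Unset Printing Implicit Defensive.

Import Order.TTheory GRing.Theory Num.Theory.
Import numFieldNormedType.Exports.

Local Open Scope classical_set_scope.
Local Open Scope ring_scope.

Section SMML.
Variables (R : realType) (p : nat).

(* Sum of a real family over a (countable) set: defined as the difference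
   of the sums of positive and negative parts (meaningful when the family
   is absolutely summable, i.e. [summable D (EFin \o g)]). *)
Definition csum (T : choiceType) (D : set T) (g : T -> R) : R :=
  fine (\esum_(x in D) ((Num.max (g x) 0)%:E)) -
  fine (\esum_(x in D) ((Num.max (- g x) 0)%:E)).

Definition rsummable (T : choiceType) (D : set T) (g : T -> R) : Prop :=
  summable D (fun x => (g x)%:E).

Definition evec (i : 'I_p) : 'rV[R]_p := delta_mx 0 i.

Definition partial (g : 'rV[R]_p -> R) (i : 'I_p) (th : 'rV[R]_p) : R :=
  derive g th (evec i).

Definition grad (g : 'rV[R]_p -> R) (th : 'rV[R]_p) : 'rV[R]_p :=
  \row_i partial g i th.

Definition hess (g : 'rV[R]_p -> R) (th : 'rV[R]_p) : 'M[R]_p :=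
  \matrix_(a, b) partial (partial g b) a th.

Fixpoint Ck_on (k : nat) (A : set 'rV[R]_p) (g : 'rV[R]_p -> R) : Prop :=
  match k with
  | 0 => forall th, A th -> {for th, continuous g}
  | k'.+1 => (forall th, A th -> {for th, continuous g}) /\
      forall i, (forall th, A th -> derivable g th (evec i)) /\
                Ck_on k' A (partial g i)
  end.

(* Lebesgue integral over R^p of a nonnegative extended-real function,
   written as the iterated integral over the coordinates (equal to the
   integral w.r.t. p-dimensional Lebesgue measure by Tonelli). *)
Fixpoint intRp (m : nat) : ('rV[R]_m -> \bar R) -> \bar R :=
  match m return ('rV[R]_m -> \bar R) -> \bar R with
  | 0 => fun g => g 0
  | m'.+1 => fun g =>
      (\int[@lebesgue_measure R]_t
         intRp (fun v : 'rV[R]_m' => g (row_mx (\row_(_ < 1) t) v)))%E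
  end.

Variables (X : countType) (f : X -> 'rV[R]_p -> R) (Theta : set 'rV[R]_p)
          (prior : 'rV[R]_p -> R).

Definition lik (n : nat) (x : n.-tuple X) (th : 'rV[R]_p) : R :=
  \prod_(i < n) f (tnth x i) th.

Definition loglik (n : nat) (x : n.-tuple X) (th : 'rV[R]_p) : R :=
  ln (lik x th).

Definition score1 (x : X) (th : 'rV[R]_p) : 'rV[R]_p :=
  grad (fun t => ln (f x t)) th.

Definition fisher1 (th : 'rV[R]_p) : 'M[R]_p :=
  \matrix_(a, b) csum setT (fun x => f x th * score1 x th 0 a * score1 x th 0 b).

Definition fisher1_exists : Prop :=
  forall th, Theta th -> forall a b,
    rsummable setT (fun x => f x th * score1 x th 0 a * score1 x th 0 b).

Definition FRlength (g : R -> 'rV[R]_p) : \bar R :=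
  (\int[@lebesgue_measure R]_(t in [set t : R | (0 <= t <= 1)%R])
     (Num.sqrt ((derive1 g t *m fisher1 (g t) *m (derive1 g t)^T) 0 0))%:E)%E.

Definition FRcurves (a b : 'rV[R]_p) : set (R -> 'rV[R]_p) :=
  [set g | (forall t : R, derivable g t (1 : R)) /\ continuous (derive1 g) /\
           g (0 : R) = a /\ g (1 : R) = b /\ (forall t, 0 <= t <= 1 -> Theta (g t))].

Definition dF (a b : 'rV[R]_p) : \bar R :=
  ereal_inf [set FRlength g | g in FRcurves a b].

Definition marginalE (n : nat) (x : n.-tuple X) : \bar R :=
  intRp (fun th => (\1_Theta th * (lik x th * prior th))%:E).

Definition marginal (n : nat) (x : n.-tuple X) : R := fine (marginalE x).

Definition is_partition (T : Type) (k : nat) (P : 'I_k -> set T) : Prop :=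
  (forall x, exists j, P j x) /\
  (forall i j, i != j -> P i `&` P j = set0).

Definition cellmass (n : nat) (C : set (n.-tuple X)) : R :=
  fine (\esum_(x in C) (marginal x)%:E).

Definition weight (n : nat) (C : set (n.-tuple X)) (x : n.-tuple X) : R :=
  marginal x / cellmass C.

(* sum_{x in C} r_n(x) l_n(x|theta) (terms are <= 0 on Theta) *)
Definition cellobj (n : nat) (C : set (n.-tuple X)) (th : 'rV[R]_p) : \bar R :=
  (- \esum_(x in C) (- (marginal x * loglik x th))%:E)%E.

Definition is_codepoint (n : nat) (C : set (n.-tuple X)) (th : 'rV[R]_p) : Prop :=
  Theta th /\ forall th', Theta th' -> (cellobj C th' <= cellobj C th)%E.

Definition codelength (n : nat) (k : nat) (P : 'I_k -> set (n.-tuple X))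
    (cp : 'I_k -> 'rV[R]_p) : \bar R :=
  ((- (\sum_(j < k) (cellmass (P j) * ln (cellmass (P j)))%:E)) +
   \sum_(j < k) \esum_(x in P j) (- (marginal x * loglik x (cp j)))%:E)%E.

Definition admissible (n : nat) (k : nat) (P : 'I_k -> set (n.-tuple X))
    (cp : 'I_k -> 'rV[R]_p) : Prop :=
  is_partition P /\ (forall j, 0 < cellmass (P j)) /\
  (forall j, is_codepoint (P j) (cp j)).

Definition optimal_SMML (n : nat) (k : nat) (P : 'I_k -> set (n.-tuple X))
    (cp : 'I_k -> 'rV[R]_p) : Prop :=
  admissible P cp /\
  forall (k' : nat) (Q : 'I_k' -> set (n.-tuple X)) (cq : 'I_k' -> 'rV[R]_p),
    admissible Q cq -> (codelength P cp <= codelength Q cq)%E.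

Definition cellmean (n : nat) (C : set (n.-tuple X))
    (mle : n.-tuple X -> 'rV[R]_p) : 'rV[R]_p :=
  \row_i csum C (fun x => weight C x * mle x 0 i).

End SMML.
Arguments evec {R p} i.

(* Main.v *)
Require Import Defs.
From HB Require Import structures.
From mathcomp Require Import all_boot all_order all_algebra.
From mathcomp Require Import all_classical all_reals all_analysis.
From mathcomp Require Import measurable_realfun ring lra.

(* At a codepoint c = theta*_j the weighted score vanishes, sum_x w(x) grad l_n(x|c) = 0.
   The MLE is an interior maximum, so the mean-value expansion (A8) gives
   grad l_n(x|c) = n (mle(x) - c) (J_1(c) + R(x)), whence
     (sum_x w(x) (mle(x) - c)) J_1(c) = - sum_x w(x) (mle(x) - c) R(x).
   Pairing with D = sum_x w(x) (mle(x) - c) and using J_1(c) >= c1 I bounds |D| by a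
   constant times sup |mle - c| * sup |R| = O(n^(-1/2)) o(1).

   The mesh bound (A7) concerns d_F and is transferred to the norm: on a compact
   neighbourhood of K the metric dominates c1 I, so a curve from a to b has, after its
   last exit from the ball of radius d around b, length at least
   sqrt c1 * min(d, |a - b|). *)

Set Implicit Arguments.
Unset Strict Implicit.
Unset Printing Implicit Defensive.

Import Order.TTheory GRing.Theory Num.Theory.
Import numFieldNormedType.Exports.

Local Open Scope classical_set_scope.
Local Open Scope ring_scope.

(** * Linearity, monotonicity and bounds for signed sums of summable families *)

Section Csum.
Context {R : realType} {T : choiceType}.
Implicit Types (D : set T) (g h u v : T -> R).

Lemma eq_csum D g h : (forall x, D x -> g x = h x) -> csum D g = csum D h.
Proof.
by move=> gh; rewrite /csum; congr (fine _ - fine _); apply: eq_esum => x Dx;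
  rewrite gh.
Qed.

Lemma csum_ge0E D g : (forall x, D x -> 0 <= g x) ->
  csum D g = fine (\esum_(x in D) (g x)%:E).
Proof.
move=> g0; rewrite /csum (eq_esum (b := fun x => (g x)%:E)); last first.
  by move=> x Dx; rewrite (max_idPl (g0 x Dx)).
by rewrite [X in _ - fine X]esum1 ?subr0// => x Dx; rewrite max_r// oppr_le0 g0.
Qed.

Lemma csum_ge0 D g : (forall x, D x -> 0 <= g x) -> 0 <= csum D g.
Proof.
by move=> g0; rewrite csum_ge0E//; apply: fine_ge0; apply: esum_ge0 => x Dx;
  rewrite lee_fin g0.
Qed.

Lemma rsummable_le D g h : (forall x, D x -> `|g x| <= h x) ->
  rsummable D h -> rsummable D g.
Proof.
move=> gh; apply: le_lt_trans; apply: le_esum => x Dx.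
by rewrite !abse_EFin lee_fin (le_trans (gh x Dx))// ler_norm.
Qed.

Lemma eq_rsummable D g h : (forall x, D x -> g x = h x) ->
  rsummable D g -> rsummable D h.
Proof.
move=> gh; rewrite /rsummable /summable [X in (X < _)%E -> _](_ : _ =
  \esum_(x in D) `|(h x)%:E|%E)//.
by apply: eq_esum => x Dx; rewrite gh.
Qed.

Lemma rsummable_ge0P D g : (forall x, D x -> 0 <= g x) ->
  (rsummable D g : Prop) <-> \esum_(x in D) (g x)%:E \is a fin_num.
Proof.
move=> g0; rewrite /rsummable summableE (eq_esum (b := fun x => (g x)%:E))//.
by move=> x Dx; rewrite gee0_abs// lee_fin g0.
Qed.

Lemma rsummableD D g h : rsummable D g -> rsummable D h ->
  rsummable D (fun x => g x + h x).
Proof. exact: summableD. Qed.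

(** The single estimate [le] gives both inequalities: used once with the factor [a] on [g], once
    with [a^-1] on [a * g]. Only [a = 0] has to be treated apart. *)
Lemma esumZl D (a : R) g : 0 <= a -> (forall x, D x -> 0 <= g x) ->
  \esum_(x in D) (a * g x)%:E = (a%:E * \esum_(x in D) (g x)%:E)%E.
Proof.
move=> a0 g0.
have le (b : R) k : 0 <= b -> (forall x, D x -> 0 <= k x) ->
    (\esum_(x in D) (b * k x)%:E <= b%:E * \esum_(x in D) (k x)%:E)%E.
  move=> b0 k0; apply: ge_ereal_sup => _ [A [fA AD] <-].
  under eq_fsbigr do rewrite EFinM.
  (* [ge0_mule_fsumr] asks for nonnegativity at every point, while [k] is nonnegative only on [D];
     truncation at 0 bridges the gap and is undone afterwards. *)
  rewrite (@eq_fsbigr _ _ _ _ _ (fun x => (b%:E * (Num.max (k x) 0)%:E)%E)); last first.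
    by move=> x; rewrite inE => /AD /k0 kx; rewrite (max_idPl kx).
  rewrite -ge0_mule_fsumr; last by move=> x; rewrite lee_fin le_max lexx orbT.
  apply: lee_wpmul2l => //.
  rewrite (@eq_fsbigr _ _ _ _ _ (fun x => (k x)%:E)); last first.
    by move=> x; rewrite inE => /AD /k0 kx; rewrite (max_idPl kx).
  by apply: ereal_sup_ubound; exists A.
apply/eqP; rewrite eq_le le//=.
have [->|an0] := eqVneq a 0.
  by rewrite mul0e; apply: esum_ge0 => x _; rewrite mul0r.
have a1 : 0 < a by rewrite lt_neqAle eq_sym an0.
have := le a^-1 (fun x => a * g x); rewrite invr_ge0 => /(_ a0).
have -> : \esum_(x in D) (a^-1 * (a * g x))%:E = \esum_(x in D) (g x)%:E.
  by apply: eq_esum => x _; rewrite mulKf.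
move=> /(_ (fun x Dx => mulr_ge0 a0 (g0 x Dx))) /(lee_wpmul2l (x := a%:E)).
by rewrite lee_fin => /(_ a0); rewrite muleA -EFinM mulfV// mul1e.
Qed.

Lemma rsummableZ D (a : R) g : rsummable D g -> rsummable D (fun x => a * g x).
Proof.
rewrite /rsummable !summableE => Dg.
rewrite (eq_esum (b := fun x => (`|a| * `|g x|)%:E)); last first.
  by move=> x Dx; rewrite abse_EFin normrM.
by rewrite esumZl// fin_numM.
Qed.

(** The value of [csum] is the same for every splitting into a difference of nonnegative summable
    families, not just for the positive and negative parts. Linearity rests on this freedom. *)
Lemma csumB D u v : rsummable D u -> rsummable D v ->
  (forall x, D x -> 0 <= u x) -> (forall x, D x -> 0 <= v x) ->
  csum D (fun x => u x - v x) =
  fine (\esum_(x in D) (u x)%:E) - fine (\esum_(x in D) (v x)%:E).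
Proof.
move=> Du Dv u0 v0.
have fu := (rsummable_ge0P u0).1 Du.
have fv := (rsummable_ge0P v0).1 Dv.
have Duv : rsummable D (fun x => u x - v x).
  apply: (rsummable_le _ (rsummableD Du Dv)) => x Dx.
  by rewrite (le_trans (ler_normB _ _))// !ger0_norm ?u0 ?v0.
have fin w : (forall x, 0 <= w x <= `|u x - v x|) ->
    \esum_(x in D) (w x)%:E \is a fin_num.
  move=> hw; apply/rsummable_ge0P => [x _|]; first by have /andP[] := hw x.
  move: Duv; rewrite /rsummable /summable; apply: le_lt_trans.
  by apply: le_esum => x _; rewrite !abse_EFin lee_fin; have /andP[w0 wl] := hw x;
    rewrite ger0_norm.
have fp : \esum_(x in D) (Num.max (u x - v x) 0)%:E \is a fin_num.
  by apply: fin => x; rewrite le_max lexx orbT/= ge_max ler_norm normr_ge0.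
have fn : \esum_(x in D) (Num.max (- (u x - v x)) 0)%:E \is a fin_num.
  by apply: fin => x; rewrite le_max lexx orbT/= ge_max normr_ge0 -normrN ler_norm.
(* Clearing the subtractions leaves (positive part) + [v] = [u] + (negative part), where all
   families are nonnegative and [esumD] applies. *)
rewrite /csum; apply/eqP; rewrite subr_eq addrAC eq_sym subr_eq eq_sym; apply/eqP.
apply: EFin_inj; rewrite !EFinD !fineK// -!esumD; last 4 first.
- by move=> x Dx; rewrite lee_fin u0.
- by move=> x Dx; rewrite lee_fin le_max lexx orbT.
- by move=> x Dx; rewrite lee_fin le_max lexx orbT.
- by move=> x Dx; rewrite lee_fin v0.
apply: eq_esum => x Dx; rewrite -!EFinD; congr EFin.
by have [] := lerP (u x - v x) 0; have [] := lerP (- (u x - v x)) 0; lra.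
Qed.

Lemma rsummable_pos D g : rsummable D g -> rsummable D (fun x => Num.max (g x) 0).
Proof.
rewrite /rsummable/summable; apply: le_lt_trans; apply: le_esum => x Dx.
by rewrite !abse_EFin lee_fin ger0_norm ?ge_max ?ler_norm ?normr_ge0// le_max lexx orbT.
Qed.

Lemma rsummableN D g : rsummable D g -> rsummable D (fun x => - g x).
Proof.
move=> Dg; apply: eq_rsummable (rsummableZ (-1) Dg) => x _.
by rewrite mulN1r.
Qed.

(** Positive parts are not additive, but the sum of the positive parts minus the sum of the negative
    parts is still a splitting of [g + h] that [csumB] accepts. *)
Lemma csumD D g h : rsummable D g -> rsummable D h ->
  csum D (fun x => g x + h x) = csum D g + csum D h.
Proof.
move=> Dg Dh.
have Dgn := rsummable_pos (rsummableN Dg); have Dhn := rsummable_pos (rsummableN Dh).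
have Dgp := rsummable_pos Dg; have Dhp := rsummable_pos Dh.
have m0 (x : R) : 0 <= Num.max x 0 by rewrite le_max lexx orbT.
have f (k : T -> R) : rsummable D (fun x => Num.max (k x) 0) ->
    \esum_(x in D) (Num.max (k x) 0)%:E \is a fin_num.
  by move=> ks; apply/rsummable_ge0P.
rewrite (@eq_csum _ _ (fun x => (Num.max (g x) 0 + Num.max (h x) 0) -
    (Num.max (- g x) 0 + Num.max (- h x) 0))); last first.
  move=> x _; have [] := lerP (g x) 0; have [] := lerP (- g x) 0;
  have [] := lerP (h x) 0; have [] := lerP (- h x) 0; lra.
rewrite csumB; [|exact: rsummableD|exact: rsummableD| |]; last 2 first.
- by move=> x Dx; rewrite addr_ge0.
- by move=> x Dx; rewrite addr_ge0.
under eq_esum do rewrite EFinD.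
under [X in _ - fine X]eq_esum do rewrite EFinD.
rewrite !esumD ?fineD; try by [exact: f|move=> x Dx; rewrite lee_fin].
by rewrite /csum; lra.
Qed.

Lemma csumZ D (a : R) g : rsummable D g -> csum D (fun x => a * g x) = a * csum D g.
Proof.
move=> Dg.
have m0 (x : R) : 0 <= Num.max x 0 by rewrite le_max lexx orbT.
have Dgn := rsummable_pos (rsummableN Dg).
have Dgp := rsummable_pos Dg.
have gE x : g x = Num.max (g x) 0 - Num.max (- g x) 0.
  by have [] := lerP (g x) 0; have [] := lerP (- g x) 0; lra.
have [a0|a0] := leP 0 a.
  rewrite (@eq_csum _ _ (fun x => a * Num.max (g x) 0 - a * Num.max (- g x) 0)).
    rewrite csumB; [|exact: rsummableZ|exact: rsummableZ| |]; last 2 first.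
    - by move=> x Dx; rewrite mulr_ge0.
    - by move=> x Dx; rewrite mulr_ge0.
    by rewrite !esumZl// !fineM/= -?mulrBr//; apply/rsummable_ge0P.
  by move=> x _; rewrite -mulrBr -gE.
(* For negative [a] the positive and negative parts of [g] trade places, each scaled by the
   nonnegative factor [- a]. *)
have Na0 : 0 <= - a by lra.
rewrite (@eq_csum _ _ (fun x => - a * Num.max (- g x) 0 - - a * Num.max (g x) 0)).
  rewrite csumB; [|exact: rsummableZ|exact: rsummableZ| |]; last 2 first.
  - by move=> x Dx; rewrite mulr_ge0.
  - by move=> x Dx; rewrite mulr_ge0.
  rewrite !esumZl// !fineM/=//; [by rewrite /csum; ring| |]; exact/rsummable_ge0P.
by move=> x _; rewrite {1}gE; ring.
Qed.

Lemma le_csum D g h : rsummable D g -> rsummable D h ->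
  (forall x, D x -> g x <= h x) -> csum D g <= csum D h.
Proof.
move=> Dg Dh gh; rewrite -subr_ge0.
rewrite (_ : _ - _ = csum D (fun x => h x + -1 * g x)).
  by apply: csum_ge0 => x Dx; rewrite mulN1r subr_ge0 gh.
by rewrite csumD ?csumZ ?mulN1r//; exact: rsummableZ.
Qed.

Lemma ler_norm_csum D g h : rsummable D h ->
  (forall x, D x -> `|g x| <= h x) -> `|csum D g| <= csum D h.
Proof.
move=> Dh gh; have Dg := rsummable_le gh Dh.
have gh' x : D x -> -1 * h x <= g x <= h x.
  by move=> /gh; rewrite ler_norml mulN1r.
rewrite ler_norml -mulN1r -csumZ//; apply/andP; split; apply: le_csum => //.
- exact: rsummableZ.
- by move=> x /gh' /andP[].
- by move=> x /gh' /andP[].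
Qed.

(** Both claims go through one induction, because additivity at each step requires the tail to be
    summable. *)
Lemma csum_sum_rsummable (I : Type) (r : seq I) D (F : I -> T -> R) :
  (forall i, rsummable D (F i)) ->
  rsummable D (fun x => \sum_(i <- r) F i x) /\
  csum D (fun x => \sum_(i <- r) F i x) = \sum_(i <- r) csum D (F i).
Proof.
move=> DF; elim: r => [|i r [IH1 IH2]].
  rewrite big_nil; split.
    apply: (@eq_rsummable _ (fun=> 0)) => [x _|]; first by rewrite big_nil.
    by rewrite /rsummable /summable esum1 ?ltry// => x _; rewrite abse0.
  by rewrite csum_ge0E ?esum1// => x _; rewrite ?big_nil.
rewrite big_cons -IH2 -csumD//; split.
  by apply: eq_rsummable (rsummableD (DF i) IH1) => x _; rewrite big_cons.
by apply: eq_csum => x _; rewrite big_cons.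
Qed.

End Csum.

(** * Local maxima, compact neighbourhoods, and increments along curves *)

Section Analysis.
Context {R : realType}.

(** Fermat's rule along one direction: the difference quotients are nonpositive from the right and
    nonnegative from the left, and both one-sided limits equal the derivative. *)
Lemma derive_at_local_max (V : normedModType R) (F : V -> R) (c v : V) :
  derivable F c v -> (\forall y \near c, F y <= F c) -> 'D_v F c = 0.
Proof.
move=> dF Fc.
have Fh : \forall h \near (0 : R), F (h *: v + c) <= F c.
  have : (fun h : R => h *: v + c) @ (0 : R) --> c.
    rewrite -[X in _ --> X]add0r -(scale0r v); apply: cvgD; last exact: cvg_cst.
    by apply: cvgZr_tmp; exact: cvg_id.
  by move=> /(_ _ Fc).
apply/eqP; rewrite eq_le; apply/andP; split.
  rewrite /derive cvg_at_rightE; last exact: dF.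
  apply: limr_le.
    rewrite -(cvg_at_rightE (fun h : R => h^-1 *: ((F \o shift c) _ - F c))) //.
    apply: cvg_trans dF; apply: cvg_app.
    move=> A [e egt0 Ae]; exists e => // x xe xgt0; apply: Ae => //.
    exact/lt0r_neq0.
  near=> h; apply: mulr_ge0_le0.
    by rewrite invr_ge0; apply: ltW; near: h; exists 1 => /=.
  rewrite subr_le0; near: h.
  exact: (cvg_within _ Fh).
rewrite /derive cvg_at_leftE; last exact: dF.
apply: limr_ge.
  rewrite -(cvg_at_leftE (fun h : R => h^-1 *: ((F \o shift c) _ - F c))) //.
  apply: cvg_trans dF; apply: cvg_app.
  move=> A [e egt0 Ae]; exists e => // x xe xgt0; apply: Ae => //.
  exact/ltr0_neq0.
near=> h; apply: mulr_le0.
  by rewrite invr_le0; apply: ltW; near: h; exists 1 => /=.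
rewrite subr_le0; near: h.
exact: (cvg_within _ Fh).
Unshelve. all: by end_near. Qed.

Lemma ler_coord_mx_norm m n (M : 'M[R]_(m, n)) i j : `|M i j| <= `|M|.
Proof.
rewrite [leRHS]/Num.Def.normr/= mx_normrE.
exact: (le_bigmax _ (fun ij => `|M ij.1 ij.2|) (i, j)).
Qed.

(** Compactness of [K] yields one radius [d] valid at all its points. The witness [K'] is the
    Minkowski sum of [K] and the closed ball of radius [d], a continuous image of a compact
    product. *)
Lemma compact_thickening p (K Th : set 'rV[R]_p) :
  compact K -> open Th -> K `<=` Th ->
  exists (d : R) (K' : set 'rV[R]_p), [/\ 0 < d, compact K', K' `<=` Th &
    forall c y, K c -> `|y - c| <= d -> K' y].
Proof.
move=> cK oTh KTh.
have : \forall d \near (0 : R)^'+, K `<=` (fun x => forall y, `|y - x| <= d -> Th y).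
  apply: ((compact_near_coveringP K).1 cK) => x Kx.
  have /nbhs_ballP[e /= e0 xe] : nbhs x Th by exact/open_nbhs_nbhs/(conj oTh)/KTh.
  have e2 : 0 < e / 2 by rewrite divr_gt0.
  (* Half of the radius [e] pays for moving the centre from [x] to [z], the other half for the
     displacement from [z] to [y]. *)
  exists (ball x (e / 2), [set d | d <= e / 2]) => /=.
    by split; [exact: nbhsx_ballx|exact: nbhs_right_le].
  move=> [z d] /= [xz de] y yz; apply: xe.
  move: xz; rewrite -ball_normE /= => xz; apply: le_lt_trans (ler_distD z _ _) _.
  by rewrite [ltRHS]splitr ltr_leD// distrC (le_trans yz).
move=> /(@filterI _ _ _ _ _ (nbhs_right_gt 0)) /filter_ex [d [/= d0 Kd]].
pose B := [set u : 'rV[R]_p | `|u| <= d].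
have cB : compact B.
  apply: bounded_closed_compact.
    by exists d; split; [exact: num_real|] => M dM u /= ud; rewrite (le_trans ud)// ltW.
  apply: (@preimage_closed _ _ (fun u : 'rV[R]_p => `|u|) [set x : R | x <= d]) => //.
    by move=> u _; exact: norm_continuous.
exists d, ((fun z => z.1 + z.2) @` (K `*` B)); split => //.
- apply: continuous_compact; last exact: compact_setX.
  by apply: continuous_subspaceT => z; apply: cvgD; [exact: cvg_fst|exact: cvg_snd].
- by move=> _ [[c u] /= [Kc uB] <-]; apply: (Kd c Kc); rewrite addrAC subrr add0r.
- by move=> c y Kc yc; exists (c, y - c) => //=; rewrite addrC subrK.
Qed.

(* The integrand of the Fisher-Rao length is not known to be measurable, hence the
   absence of measurability hypotheses. *)
Lemma le_nonneg_integral d (T : measurableType d) (mu : {measure set T -> \bar R})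
    (D E : set T) (F G : T -> \bar R) :
  D `<=` E -> (forall x, D x -> 0 <= F x)%E -> (forall x, E x -> 0 <= G x)%E ->
  (forall x, D x -> F x <= G x)%E ->
  (\int[mu]_(x in D) F x <= \int[mu]_(x in E) G x)%E.
Proof.
move=> DE F0 G0 FG; rewrite !ge0_integralE//.
apply: ereal_sup_le => _ /= [h hF <-]; exists h => // x.
apply: le_trans (hF x) _; rewrite !patchE.
case: ifPn => [|_]; last by case: ifPn => //; rewrite inE => /G0.
by rewrite inE => Dx; rewrite mem_set; [exact: FG|exact: DE].
Qed.

(** The fundamental theorem of calculus on [[a, b]] writes the increment as an integral of the
    derivative; nonnegativity of [F] then permits enlarging the domain to [D]. *)
Lemma le_increment_integral (G F : R -> R) (a b : R) (D : set R) :
  a < b -> `[a, b] `<=` D ->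
  (forall t, derivable G t 1) -> continuous (derive1 G) ->
  (forall t, 0 <= F t) -> (forall t, a <= t <= b -> `|derive1 G t| <= F t) ->
  (`|G b - G a|%:E <= \int[@lebesgue_measure R]_(t in D) (F t)%:E)%E.
Proof.
move=> ab abD dG cG F0 GF.
have cGab : {within `[a, b], continuous (derive1 G)} by exact: continuous_subspaceT.
have cont : continuous G.
  by move=> x; apply: differentiable_continuous; exact/derivable1_diffP.
have /esym e : (\int[@lebesgue_measure R]_(x in `[a, b]) (derive1 G x)%:E =
    (G b)%:E - (G a)%:E)%E.
  apply: continuous_FTC2 => //; split => //.
    by apply: cvg_at_right_filter; exact: cont.
  by apply: cvg_at_left_filter; exact: cont.
rewrite -abse_EFin EFinB e.
apply: le_trans (le_abse_integral _ _ _) _ => //.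
  by apply/measurable_EFinP; exact: subspace_continuous_measurable_fun.
by apply: le_nonneg_integral => // x _; rewrite lee_fin F0.
Qed.

(** The time [s] is the largest point of [[0, 1]] at which [phi] is at least [d], or 0 if [phi]
    never exceeds [d]. *)
Lemma last_exit (phi : R -> R) (d : R) : continuous phi -> 0 < d -> phi 1 = 0 ->
  exists s, [/\ 0 <= s <= 1, (forall t, s <= t <= 1 -> phi t <= d) &
    Num.min d (phi 0) <= phi s].
Proof.
move=> cphi d0 phi1.
have [lt_d0|] := pselect (forall t, 0 <= t <= 1 -> phi t <= d).
  by exists 0; rewrite lexx ler01 ge_min lexx orbT.
move=> /existsNP[t0 /not_implyP[t001 /negP]]; rewrite -ltNge => dt0.
pose A := `[0, 1] `&` phi @^-1` [set x : R | d <= x].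
have cA : compact A.
  apply: (subclosed_compact _ (@segment_compact R 0 1)); last by move=> ? [].
  apply: closedI; first exact: itv_closed.
  by apply: preimage_closed => [x _|]; [exact: cphi|exact: closed_ge].
have A0 : A !=set0 by exists t0; split; rewrite /= ?in_itv//= ltW.
have [s] := compact_EVT_max A0 cA (@continuous_subspaceT _ _ A id (fun=> cvg_id)).
rewrite inE => -[/=]; rewrite in_itv/= => /andP[s0 s1] ds smax.
exists s; split; rewrite ?s0 ?s1//; last by rewrite ge_min ds.
move=> t /andP[st t1]; rewrite leNgt; apply/negP => dt.
(* A value above [d] at a time [t >= s] would, as [phi 1 = 0], force the level [d] to be met at some
   [u >= t]. Maximality of [s] gives [u <= s], hence [t = u], which is absurd. *)
have [|u] := @IVT R phi t 1 d t1 (continuous_subspaceT cphi).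
  by rewrite phi1 ge_min le_max (ltW d0) (ltW dt) orbT.
rewrite in_itv/= => /andP[tu u1] phiu.
have us : u <= s.
  apply: smax; rewrite inE; split; rewrite /= ?in_itv/= ?phiu// u1.
  by rewrite (le_trans _ tu)// (le_trans s0).
have tE : t = u by apply/eqP; rewrite eq_le tu (le_trans us).
by move: dt; rewrite tE phiu ltxx.
Qed.

End Analysis.

(** * Lower bound of the Fisher-Rao distance by the norm *)

Section FisherRao.
Context {R : realType} {p : nat} {X : countType}.
Variables (f : X -> 'rV[R]_p -> R) (Theta : set 'rV[R]_p).

(** Only the part of a curve after its last exit from the ball around [b] is measured, since the
    information is controlled there. The norm is the largest entry in absolute value, so the scalar
    increment of one coordinate suffices. *)
Lemma dF_lower_bound (c1 d : R) (a b : 'rV[R]_p) : 0 < c1 -> 0 < d ->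
  (forall y, `|y - b| <= d -> forall v : 'rV[R]_p,
     c1 * (v *m v^T) 0 0 <= (v *m fisher1 f y *m v^T) 0 0) ->
  ((Num.sqrt c1 * Num.min d `|a - b|)%:E <= dF f Theta a b)%E.
Proof.
move=> c10 d0 Jb; apply: le_ereal_inf_tmp => _ /= [g [dg [cg [g0 [g1 _]]]] <-].
set F := fun t => Num.sqrt ((derive1 g t *m fisher1 f (g t) *m (derive1 g t)^T) 0 0).
have cont : continuous g.
  by move=> t; apply: differentiable_continuous; exact/derivable1_diffP.
have [|||s [/andP[s0 s1] gs gsb]] := @last_exit R (fun t => `|g t - b|) d.
- move=> t; apply: continuous_comp; last exact: norm_continuous.
  by apply: continuousB; [exact: cont|exact: cvg_cst].
- exact: d0.
- by rewrite g1 subrr normr0.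
have {}gsb : Num.min d `|a - b| <= `|g s - b| by rewrite -g0.
have len0 : (0 <= FRlength f g)%E.
  by apply: integral_ge0 => t _; rewrite lee_fin sqrtr_ge0.
(* If the curve is already at [b] at time [s], then the minimum in the bound is at most 0 and the
   length is nonnegative. *)
have [gsb0|gsb0] := eqVneq `|g s - b| 0.
  apply: le_trans len0; rewrite lee_fin mulr_ge0_le0 ?sqrtr_ge0//.
  by rewrite -gsb0.
have [[i0 i] /= ni] := mx_norm_neq0 gsb0.
have {}ni : `|g s - b| = `|(g s - b) 0 i| by rewrite -(ord1 i0).
have {}s1 : s < 1.
  by rewrite lt_neqAle s1 andbT; apply: contra_neq gsb0 => ->; rewrite g1 subrr normr0.
have c0 : 0 <= Num.sqrt c1 by exact: sqrtr_ge0.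
pose G := fun t => Num.sqrt c1 * g t 0 i.
have dgi t : derivable (fun t => g t 0 i) t 1 by move/derivable_mxP : (dg t).
have G'E t : derive1 G t = Num.sqrt c1 * derive1 g t 0 i.
  by rewrite !derive1E (derive_mx (dg t)) mxE [LHS](@deriveZ _ _ _ (fun t => g t 0 i)).
apply: (@le_trans _ _ (`|G 1 - G s|)%:E).
  rewrite lee_fin -mulrBr normrM (ger0_norm c0) ler_wpM2l//.
  by rewrite (le_trans gsb)// ni g1 distrC !mxE.
apply: (@le_increment_integral _ G F).
- exact: s1.
- by move=> t /=; rewrite in_itv/= => /andP[st ->]; rewrite (le_trans s0 st).
- by move=> t; apply: derivableZ.
- rewrite (_ : derive1 G = fun t => Num.sqrt c1 * derive1 g t 0 i); last exact/funext.
  move=> t; apply: cvgM; first exact: cvg_cst.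
  apply: (@continuous_comp _ _ _ (derive1 g) (fun M => M 0 i)); first exact: cg.
  exact: coord_continuous.
- by move=> t; exact: sqrtr_ge0.
(* With [v] the velocity, [c1 * v_i ^+ 2] is at most [c1] times the sum of squares of [v], hence at
   most the Fisher quadratic form, as the curve stays within [d] of [b]. *)
- move=> t st; rewrite G'E normrM (ger0_norm c0) -sqrtr_sqr -sqrtrM ?(ltW c10)//.
  apply: ler_wsqrtr; rewrite (le_trans _ (Jb _ (gs _ st) _))// ler_pM2l// mxE.
  by rewrite (bigD1 i)//= mxE -expr2 lerDl sumr_ge0// => j _; rewrite mxE -expr2 sqr_ge0.
Qed.

End FisherRao.

(** * Sign of the log-likelihood and stationarity of codepoints *)

Section Codepoint.
Context {R : realType} {p : nat} {X : countType}.
Variables (f : X -> 'rV[R]_p -> R) (Theta : set 'rV[R]_p) (prior : 'rV[R]_p -> R).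
Hypothesis f_ge0 : forall x th, Theta th -> 0 <= f x th.
Hypothesis f_sum1 : forall th, Theta th ->
  rsummable setT (fun x => f x th) /\ csum setT (fun x => f x th) = 1.
Hypothesis prior_ge0 : forall th, Theta th -> 0 <= prior th.

Lemma intRp_ge0 m (g : 'rV[R]_m -> \bar R) :
  (forall v, (0 <= g v)%E) -> (0 <= intRp g)%E.
Proof.
by elim: m g => [|m IH] g g0 /=; [exact: g0|apply: integral_ge0 => t _; exact: IH].
Qed.

Lemma marginal_ge0 n (x : n.-tuple X) : 0 <= marginal f Theta prior x.
Proof.
apply/fine_ge0/intRp_ge0 => th; rewrite lee_fin indicE.
case: (boolP (th \in Theta)) => [|_]; last by rewrite mul0r.
by rewrite inE => Tth; rewrite mul1r mulr_ge0 ?prior_ge0// prodr_ge0// => i _; exact: f_ge0.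
Qed.

Lemma pmf_le1 x th : Theta th -> f x th <= 1.
Proof.
move=> Tth; have [sf <-] := f_sum1 Tth; have f0 y (_ : setT y) := f_ge0 y Tth.
rewrite csum_ge0E// -lee_fin fineK; last exact/rsummable_ge0P.
apply: esum_ge; exists [set x]; first by split.
by rewrite fsbig_set1.
Qed.

(** A mass function is at most 1, hence so is the likelihood; a zero likelihood is covered because
    [ln] takes the value 0 there. This sign lets the extended-real [cellobj] be compared with a
    [csum]. *)
Lemma loglik_le0 n (x : n.-tuple X) th : Theta th -> loglik f x th <= 0.
Proof.
move=> Tth; apply: ln_le0; rewrite /lik.
by apply: prodr_ile1 => i _; rewrite f_ge0// pmf_le1.
Qed.

(** Near [c] the terms are summable and nonpositive, so [csum] agrees with [cellobj], which [c]
    maximises over [Theta]. Openness of [Theta] turns this into a local maximum. *)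
Lemma codepoint_stationary n (C : set (n.-tuple X)) c i :
  open Theta -> is_codepoint f Theta prior C c ->
  (\forall th \near c, rsummable C (fun x => marginal f Theta prior x * loglik f x th)) ->
  derivable (fun th => csum C (fun x => marginal f Theta prior x * loglik f x th)) c
    (evec i) ->
  partial (fun th => csum C (fun x => marginal f Theta prior x * loglik f x th)) i c = 0.
Proof.
move=> oT [Tc cmax] sC dC; apply: derive_at_local_max => //.
have csumE th : Theta th ->
    rsummable C (fun x => marginal f Theta prior x * loglik f x th) ->
    (csum C (fun x => marginal f Theta prior x * loglik f x th))%:E =
    cellobj f Theta prior C th.
  move=> Tth sth.
  have rl0 x : C x -> 0 <= - (marginal f Theta prior x * loglik f x th).
    by move=> _; rewrite oppr_ge0 mulr_ge0_le0 ?marginal_ge0 ?loglik_le0.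
  rewrite (eq_csum (h := fun x => -1 * - (marginal f Theta prior x * loglik f x th))).
    rewrite csumZ ?csum_ge0E//; last exact: rsummableN.
    rewrite mulN1r EFinN fineK//; apply/rsummable_ge0P => //; exact: rsummableN.
  by move=> x _; rewrite mulN1r opprK.
have sc := nbhs_singleton sC.
near=> th.
have Tth : Theta th by near: th; exact: open_nbhs_nbhs.
by rewrite -lee_fin !csumE//; [exact: cmax|near: th].
Unshelve. all: by end_near. Qed.

End Codepoint.

(** * Weighted estimating equation, norm form of the mesh bound, and the final rate *)

(* Testing the weighted estimating equation [sum w d (J + Rm) = 0] against the
   weighted mean of [d] itself leaves only the remainder term on the right. *)
Lemma weighted_mean_bound (R : realType) (p : nat) (T : choiceType) (C : set T)
    (w : T -> R) (d : T -> 'rV[R]_p) (Rm : T -> 'M[R]_p) (J : 'M[R]_p)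
    (c1 M e : R) :
  0 < c1 -> 0 <= M -> 0 <= e ->
  (forall x, C x -> 0 <= w x) -> rsummable C w -> csum C w = 1 ->
  (forall x, C x -> `|d x| <= M) -> (forall x, C x -> `|Rm x| <= e) ->
  (forall v : 'rV[R]_p, c1 * (v *m v^T) 0 0 <= (v *m J *m v^T) 0 0) ->
  (forall b, csum C (fun x => w x * (d x *m (J + Rm x)) 0 b) = 0) ->
  (forall i, rsummable C (fun x => w x * d x 0 i)) /\
  `|\row_i csum C (fun x => w x * d x 0 i)| <= p%:R ^+ 2 * M * e / c1.
Proof.
move=> c10 M0 e0 w0 sw w1 dM Re Jc1 score.
set D := \row_i _.
(* The weights form a probability on [C], so averaging a bounded family is legitimate and keeps the
   bound. *)
have bnd (g : T -> R) B : 0 <= B -> (forall x, C x -> `|g x| <= B) ->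
    rsummable C (fun x => w x * g x) /\ `|csum C (fun x => w x * g x)| <= B.
  move=> B0 gB.
  have wg x : C x -> `|w x * g x| <= B * w x.
    by move=> Cx; rewrite normrM ger0_norm ?w0// mulrC ler_wpM2r ?w0// gB.
  have sB := rsummableZ B sw; split; first exact: rsummable_le wg sB.
  by rewrite (le_trans (ler_norm_csum sB wg))// csumZ// w1 mulr1.
have dR x a : C x -> `|(d x *m Rm x) 0 a| <= p%:R * M * e.
  move=> Cx; rewrite mxE (le_trans (ler_norm_sum _ _ _))//.
  apply: le_trans (_ : \sum_(k < p) M * e <= _); last first.
    by rewrite sumr_const card_ord -[leLHS]mulr_natl mulrA.
  apply: ler_sum => k _; rewrite normrM ler_pM//.
    exact: le_trans (ler_coord_mx_norm _ _ _) (dM _ Cx).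
  exact: le_trans (ler_coord_mx_norm _ _ _) (Re _ Cx).
have sd i : rsummable C (fun x => w x * d x 0 i).
  apply: (bnd _ M _ _).1 => // x Cx.
  exact: le_trans (ler_coord_mx_norm _ _ _) (dM _ Cx).
split => //.
pose E := \row_a csum C (fun x => w x * (d x *m Rm x) 0 a).
have pMe : 0 <= p%:R * M * e by rewrite !mulr_ge0.
have Ebnd a : `|E 0 a| <= p%:R * M * e.
  by rewrite mxE; apply: (bnd _ _ pMe _).2 => x; exact: dR.
have DJE : D *m J = - E.
  apply/rowP => b; have := score b.
  rewrite (eq_csum (h := fun x =>
      \sum_k J k b * (w x * d x 0 k) + w x * (d x *m Rm x) 0 b)); last first.
    move=> x _; rewrite mulmxDr [(d x *m J + _) 0 b]mxE mulrDr; congr (_ + _).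
    by rewrite mxE mulr_sumr; apply: eq_bigr => k _; rewrite mulrA mulrC.
  have [s1 s2] := csum_sum_rsummable (index_enum 'I_p) (fun k => rsummableZ (J k b) (sd k)).
  rewrite csumD//; last first.
    by apply: (bnd _ _ pMe _).1 => x; exact: dR.
  rewrite s2 => /eqP; rewrite addr_eq0 => /eqP.
  rewrite !mxE => <-; apply: eq_bigr => k _; rewrite csumZ// mxE mulrC.
  by [].
clearbody D E.
have [->|Dn0] := eqVneq `|D| 0; first by rewrite !mulr_ge0// ?invr_ge0 ?ltW.
have D0 : 0 < `|D| by rewrite lt_neqAle eq_sym Dn0 normr_ge0.
have [[i0 i] /= Di] := mx_norm_neq0 Dn0; rewrite (ord1 i0) in Di.
(* After multiplication by [|D|] the goal follows from [c1 * |D| ^+ 2 <= c1 * D D^T <= D J D^T = - E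
   D^T], since [|D|] is the absolute value of one entry of [D]. *)
rewrite ler_pdivlMr// mulrC -(ler_pM2r D0).
have -> : c1 * `|D| * `|D| = c1 * (D 0 i) ^+ 2.
  by rewrite -mulrA -expr2 [`|D|]Di real_normK// num_real.
apply: le_trans (_ : c1 * (D *m D^T) 0 0 <= _).
  rewrite ler_pM2l// mxE (bigD1 i)//= mxE -expr2 lerDl sumr_ge0// => j _.
  by rewrite mxE -expr2 sqr_ge0.
apply: le_trans (Jc1 D) _; rewrite DJE mulNmx mxE mxE.
apply: le_trans (ler_norm _) _; rewrite normrN (le_trans (ler_norm_sum _ _ _))//.
(* This pairing contributes a second factor [p]; the first came from the product [d x *m Rm x]. *)
apply: le_trans (_ : \sum_(k < p) (p%:R * M * e) * `|D| <= _).
  by apply: ler_sum => k _; rewrite normrM ler_pM// mxE ler_coord_mx_norm.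
by rewrite sumr_const card_ord -[leLHS]mulr_natl !mulrA expr2.
Qed.

(** Curves ending in [K] may leave [K], so the eigenvalue bound is taken on a compact thickening of
    [K] inside [Theta]; its radius becomes the cutoff [d]. *)
Lemma dF_dominates_norm (R : realType) (p : nat) (X : countType)
    (f : X -> 'rV[R]_p -> R) (Theta K : set 'rV[R]_p) :
  open Theta -> compact K -> K `<=` Theta ->
  (forall Kc : set 'rV[R]_p, compact Kc -> Kc `<=` Theta ->
     exists c1 c2 : R, 0 < c1 /\ c1 <= c2 /\
       forall th, Kc th -> forall v : 'rV[R]_p,
         c1 * (v *m v^T) 0 0 <= (v *m fisher1 f th *m v^T) 0 0
         <= c2 * (v *m v^T) 0 0) ->
  exists c d : R, [/\ 0 < c, 0 < d &
    forall a b, K b -> ((c * Num.min d `|a - b|)%:E <= dF f Theta a b)%E].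
Proof.
move=> oT cK KT A5.
have [d [K' [d0 cK' K'T KK']]] := compact_thickening cK oT KT.
have [c1 [c2 [c10 [_ c1J]]]] := A5 K' cK' K'T.
exists (Num.sqrt c1), d; split; rewrite ?sqrtr_gt0// => a b Kb.
apply: dF_lower_bound => // y yb v.
by have /andP[] := c1J y (KK' b y Kb yb) v.
Qed.

Lemma near_lt_sqrt (R : realType) (A : R) :
  \forall n \near \oo, A < Num.sqrt (n%:R : R).
Proof.
near=> n; apply: le_lt_trans (ler_norm A) _.
rewrite -sqrtr_sqr ltr_sqrt; near: n; first exact: nbhs_infty_gtr.
by exists 1%N => // n /= n1; rewrite ltr0n.
Unshelve. all: by end_near. Qed.

Theorem mainTheorem4 (R : realType) (p : nat) (X : countType)
  (f : X -> 'rV[R]_p -> R) (Theta : set 'rV[R]_p) (th0 : 'rV[R]_p)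
  (prior : 'rV[R]_p -> R)
  (k : nat -> nat) (P : forall n : nat, 'I_(k n) -> set (n.-tuple X))
  (cp : forall n : nat, 'I_(k n) -> 'rV[R]_p)
  (mle : forall n : nat, n.-tuple X -> 'rV[R]_p)
  (K : set 'rV[R]_p) :
  (* f(. | theta) is a probability mass function on X for theta in Theta *)
  (forall x th, Theta th -> 0 <= f x th) ->
  (forall th, Theta th ->
     rsummable setT (fun x => f x th) /\ csum setT (fun x => f x th) = 1) ->
  (* (A1) *)
  open Theta ->
  (* (A2) *)
  Theta^° th0 ->
  (* (A3) *)
  (forall x th th', Theta th -> Theta th' -> (0 < f x th) = (0 < f x th')) ->
  (forall th, Theta th -> 0 <= prior th) ->
  intRp (fun th => (\1_Theta th * prior th)%:E) = 1%E ->
  (\forall th \near th0, 0 < prior th /\ {for th, continuous prior}) ->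
  (forall n (x : n.-tuple X), (marginalE f Theta prior x < +oo)%E) ->
  (* (A4) *)
  (forall n (x : n.-tuple X), Ck_on 3 Theta (loglik f x)) ->
  (forall n (j : 'I_(k n)) x, P n j x -> K (cp n j) ->
     Theta (mle n x) /\
     forall th, Theta th -> loglik f x th <= loglik f x (mle n x)) ->
  (* (A5) *)
  fisher1_exists f Theta ->
  (forall Kc : set 'rV[R]_p, compact Kc -> Kc `<=` Theta ->
     exists c1 c2 : R, 0 < c1 /\ c1 <= c2 /\
       forall th, Kc th -> forall v : 'rV[R]_p,
         c1 * (v *m v^T) 0 0 <= (v *m fisher1 f th *m v^T) 0 0
         <= c2 * (v *m v^T) 0 0) ->
  (* (A6): differentiation under the sum defining the codepoint objective *)
  (forall n (j : 'I_(k n)), K (cp n j) ->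
     (\forall th \near cp n j,
        rsummable (P n j) (fun x => marginal f Theta prior x * loglik f x th)) /\
     forall i : 'I_p,
       rsummable (P n j)
         (fun x => marginal f Theta prior x * partial (loglik f x) i (cp n j)) /\
       derivable (fun th => csum (P n j)
                    (fun x => marginal f Theta prior x * loglik f x th))
                 (cp n j) (evec i) /\
       partial (fun th => csum (P n j)
                  (fun x => marginal f Theta prior x * loglik f x th)) i (cp n j)
       = csum (P n j)
           (fun x => marginal f Theta prior x * partial (loglik f x) i (cp n j))) ->
  (* (A7) *)
  (forall Kc : set 'rV[R]_p, compact Kc -> Kc `<=` Theta ->
     exists C : R, \forall n \near \oo,
       forall j : 'I_(k n), Kc (cp n j) -> forall x, P n j x ->
         (dF f Theta (mle n x) (cp n j) <= (C / Num.sqrt (n%:R))%:E)%E) ->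
  (* (A8) *)
  (forall Kc : set 'rV[R]_p, compact Kc -> Kc `<=` Theta ->
     forall jj : forall n : nat, 'I_(k n), (forall n, Kc (cp n (jj n))) ->
     exists (tt : forall n : nat, n.-tuple X -> 'rV[R]_p)
            (Rm : forall n : nat, n.-tuple X -> 'M[R]_p),
       (\forall n \near \oo, forall x, P n (jj n) x ->
          (exists s : R, 0 <= s <= 1 /\
             tt n x = (1 - s) *: mle n x + s *: cp n (jj n)) /\
          grad (loglik f x) (cp n (jj n)) - grad (loglik f x) (mle n x)
            = (cp n (jj n) - mle n x) *m hess (loglik f x) (tt n x) /\
          - ((n%:R)^-1 *: hess (loglik f x) (tt n x))
            = fisher1 f (cp n (jj n)) + Rm n x) /\
       (forall e : R, 0 < e ->
          \forall n \near \oo, forall x, P n (jj n) x -> `|Rm n x| <= e)) ->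
  (* optimal SMML partitions with their codepoints *)
  (forall n, optimal_SMML f Theta prior (P n) (cp n)) ->
  (* the fixed compact K *)
  compact K -> K `<=` Theta ->
  forall j : forall n : nat, 'I_(k n), (forall n, K (cp n (j n))) ->
    (\forall n \near \oo, forall i : 'I_p,
       rsummable (P n (j n))
         (fun x => weight f Theta prior (P n (j n)) x * mle n x 0 i)) /\
    ((fun n : nat => Num.sqrt (n%:R) *
        `| cp n (j n) - cellmean f Theta prior (P n (j n)) (mle n) |)
       @ \oo --> (0 : R)).
Proof.
move=> f_ge0 f_sum1 oT _ _ prior_ge0 _ _ _ smooth mleP _ A5 A6 A7 A8 opt cK KT j Kj.
have [c [d [c0 d0 dFb]]] := dF_dominates_norm oT cK KT A5.
have [c1 [c2 [c10 [_ c1J]]]] := A5 K cK KT.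
have [C0 A7K] := A7 K cK KT.
have [tt [Rm [A8a A8b]]] := A8 K cK KT j Kj.
(* The mesh constant in the norm; the absolute value is there because (A7) does not fix the sign of
   [C0]. *)
pose M := `|C0| / c.
have M0 : 0 <= M by rewrite divr_ge0// ltW.
have mesh : \forall n \near \oo, forall x, P n (j n) x ->
    `|mle n x - cp n (j n)| <= M / Num.sqrt n%:R.
  near=> n => x Px.
  (* Beyond the threshold [|C0| / (c * d)] the mesh bound falls below [c * d], which rules out [d]
     as the smaller argument of the minimum. *)
  have sn : Num.max 0 (`|C0| / (c * d)) < Num.sqrt (n%:R : R).
    by near: n; exact: near_lt_sqrt.
  have {sn} [sn0 snd] : 0 < Num.sqrt (n%:R : R) /\ `|C0| / (c * d) < Num.sqrt (n%:R : R).
    by apply/andP; rewrite -gt_max.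
  have dFn : (dF f Theta (mle n x) (cp n (j n)) <= (C0 / Num.sqrt n%:R)%:E)%E.
    by apply: (near A7K n) => //; exact: Kj.
  have := le_trans (dFb (mle n x) _ (Kj n)) dFn; rewrite lee_fin.
  have C0n : C0 / Num.sqrt n%:R <= `|C0| / Num.sqrt n%:R.
    by rewrite ler_wpM2r ?ler_norm// invr_ge0 ltW.
  move=> /le_trans/(_ C0n); rewrite mulrC -ler_pdivlMr// mulrAC -/M ge_min => /orP[|//].
  rewrite ler_pdivlMr// /M mulrAC ler_pdivlMr// leNgt => /negP[].
  by move: snd; rewrite ltr_pdivrMr ?mulr_gt0//; lra.
have main e : 0 < e -> \forall n \near \oo,
    (forall i, rsummable (P n (j n))
       (fun x => weight f Theta prior (P n (j n)) x * mle n x 0 i)) /\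
    Num.sqrt n%:R * `|cp n (j n) - cellmean f Theta prior (P n (j n)) (mle n)| <=
      p%:R ^+ 2 * M * e / c1.
  move=> e0; near=> n.
  have n0 : (0 < n)%N by near: n; exists 1%N.
  have sn0 : 0 < Num.sqrt (n%:R : R) by rewrite sqrtr_gt0 ltr0n.
  have [[_ [qpos cpP]] _] := opt n.
  set C := P n (j n); set th := cp n (j n).
  have q0 : 0 < cellmass f Theta prior C by exact: qpos.
  have r0 (x : n.-tuple X) : 0 <= marginal f Theta prior x by exact: marginal_ge0.
  (* [fine] sends infinite values to 0, so a positive [cellmass] forces the underlying sum to be
     finite. *)
  have sr : rsummable C (marginal f Theta prior (n := n)).
    apply/rsummable_ge0P => //; move: q0; rewrite /cellmass fin_numElt.
    case: esum => //=; rewrite ?ltxx// => r _; by rewrite ltNyr ltry.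
  have wE x : weight f Theta prior C x =
      (cellmass f Theta prior C)^-1 * marginal f Theta prior x by rewrite mulrC.
  have w0 x : C x -> 0 <= weight f Theta prior C x.
    by move=> _; rewrite divr_ge0// ltW.
  have sw : rsummable C (weight f Theta prior C).
    by apply: eq_rsummable (rsummableZ (cellmass f Theta prior C)^-1 sr).
  have w1 : csum C (weight f Theta prior C) = 1.
    rewrite (eq_csum (h := fun x =>
      (cellmass f Theta prior C)^-1 * marginal f Theta prior x))//.
    by rewrite csumZ// csum_ge0E// -/(cellmass f Theta prior C) mulVf// gt_eqF.
  have dM x : C x -> `|mle n x - th| <= M / Num.sqrt n%:R.
    by move=> Cx; exact: (near mesh n).
  have Re x : C x -> `|Rm n x| <= e.
    by move=> Cx; apply: (near (A8b e e0) n).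
  have [sl derl] := A6 n (j n) (Kj n).
  (* By (A8) the vector [(mle n x - th) *m (fisher1 f th + Rm n x)] equals [n^-1] times the score at
     [th]. Its weighted sum is thus a multiple of the score sum, which vanishes by stationarity of
     the codepoint. *)
  have score b : csum C (fun x => weight f Theta prior C x *
      ((mle n x - th) *m (fisher1 f th + Rm n x)) 0 b) = 0.
    have [sb [db pb]] := derl b.
    have zero : csum C (fun x => marginal f Theta prior x * partial (loglik f x) b th) = 0.
      by rewrite -pb; apply: (codepoint_stationary f_ge0 f_sum1 prior_ge0 oT (cpP _)).
    rewrite (eq_csum (h := fun x => (cellmass f Theta prior C * n%:R)^-1 *
        (marginal f Theta prior x * partial (loglik f x) b th))).
      by rewrite csumZ// zero mulr0.
    move=> x Cx.
    have [_ [gradE hessE]] : (exists s : R, 0 <= s <= 1 /\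
       tt n x = (1 - s) *: mle n x + s *: cp n (j n)) /\
      grad (loglik f x) (cp n (j n)) - grad (loglik f x) (mle n x)
         = (cp n (j n) - mle n x) *m hess (loglik f x) (tt n x) /\
      - ((n%:R)^-1 *: hess (loglik f x) (tt n x)) = fisher1 f (cp n (j n)) + Rm n x.
      by apply: (near A8a n).
    have [Tm mmax] := mleP n (j n) x Cx (Kj n).
    have gm0 : grad (loglik f x) (mle n x) = 0.
      apply/rowP => i; rewrite !mxE; apply: derive_at_local_max.
        by have [_ /(_ i)[/(_ _ Tm)]] := smooth n x.
      near=> y; apply: mmax; near: y; exact: open_nbhs_nbhs.
    have -> : partial (loglik f x) b th = grad (loglik f x) th 0 b by rewrite mxE.
    rewrite -[grad _ th]subr0 -gm0 gradE -hessE wE.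
    rewrite mulmxN -scalemxAr -[mle n x - th]opprB mulNmx scalerN opprK [in LHS]mxE.
    by rewrite invfM; ring.
  have Jc v := proj1 (andP (c1J th (Kj n) v)).
  have Msn : 0 <= M / Num.sqrt n%:R by rewrite divr_ge0// ltW.
  have [sd bound] := weighted_mean_bound c10 Msn (ltW e0) w0 sw w1 dM Re Jc score.
  (* Recentring at [th]: the weights sum to 1, so the cell mean minus [th] is the weighted mean of
     the deviations. *)
  have mleE x i : weight f Theta prior C x * mle n x 0 i =
      weight f Theta prior C x * (mle n x - th) 0 i + th 0 i * weight f Theta prior C x.
    by rewrite !mxE; ring.
  have sth i := rsummableZ (th 0 i) sw.
  split.
    move=> i; apply: eq_rsummable (rsummableD (sd i) (sth i)) => x _.
    by rewrite mleE.
  rewrite distrC.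
  have -> : cellmean f Theta prior C (mle n) - th =
      \row_i csum C (fun x => weight f Theta prior C x * (mle n x - th) 0 i).
    apply/rowP => i; rewrite !mxE (eq_csum (fun x _ => mleE x i)) csumD//.
    by rewrite csumZ// w1 mulr1 addrK.
  (* The factor [Num.sqrt n%:R] cancels against the mesh bound [M / Num.sqrt n%:R], leaving only the
     arbitrarily small [e]. *)
  rewrite mulrC -ler_pdivlMr// (le_trans bound)// le_eqVlt; apply/orP; left; apply/eqP.
  by ring.
split.
  by apply: filterS (main 1 ltr01) => n [].
apply/cvgrPdist_le => e e0.
pose B := p%:R ^+ 2 * M / c1.
have B0 : 0 <= B by apply: divr_ge0; [rewrite mulr_ge0 ?exprn_ge0|exact: ltW].
(* [B] may be 0, so the tolerance for the remainder is [e / (B + 1)], giving the final bound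
   [B * e / (B + 1) <= e]. *)
have B1 : 0 < B + 1 by rewrite ltr_wpDl.
have e'0 : 0 < e / (B + 1) by rewrite divr_gt0.
apply: filterS (main _ e'0) => n [_ /le_trans]; rewrite sub0r normrN.
rewrite ger0_norm ?mulr_ge0 ?sqrtr_ge0//; apply.
rewrite [leLHS](_ : _ = B * e / (B + 1)); last by rewrite /B; ring.
by rewrite ler_pdivrMr// [leRHS]mulrC ler_wpM2r ?(ltW e0)// lerDl.
Unshelve. all: by end_near. Qed.
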